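(* Let $\ell\in\tfrac12\mathbb N$ and $\nu\ge1$. The functions $$\Gamma_2^{(\nu)}(y)=y(1-y)(\Psi_0(y)^* )^{-1}(T^{(\nu)})^{-1}T^{(\nu+1)}\Psi_0(y)^*,\qquad \Gamma_1^{(\nu)}(y)=(W^{(\nu)}(y))^{-1}(W^{(\nu+1)}(y))'$$ on $(0,1)$ are matrix polynomials of degree two and one, respectively.
   Context: Matrices have size $2\ell+1$, indices $0,\dots,2\ell$; $(a)_i=a(a+1)\cdots(a+i-1)$; $^*$ is conjugate transpose. $T^{(\nu)}$ is the diagonal matrix with $T^{(\nu)}_{i,i}=\binom{2\ell}{i}\frac{(\nu)_i}{(\nu+2\ell-i)_i}$ for $i=0,\dots,\lfloor\ell\rfloor$ and $T^{(\nu)}_{i,i}=T^{(\nu)}_{2\ell-i,2\ell-i}$. $\Psi_0(y)=\Phi_0(\arccos(1-2y))$, where for $n,m\in\{0,\dots,2\ell\}$ $$(\Phi_0(t))_{n,m}=\sum_{j_1=-\frac n2}^{\frac n2}\ \sum_{j_2=-\frac{2\ell-n}{2}}^{\frac{2\ell-n}{2}}\delta_{-\ell+m,\,j_1+j_2}\binom{n}{j_1+\frac n2}\binom{2\ell-n}{j_2+\frac{2\ell-n}{2}}\binom{2\ell}{2\ell-m}^{-1}e^{i(j_2-j_1)t}$$ ($j_1,j_2$ in unit steps); $\Psi_0(y)$ is invertible for $y\in(0,1)$. $W^{(\nu)}(y)=(1-y)^{\nu-1/2}y^{\nu-1/2}\Psi_0(y)T^{(\nu)}\Psi_0(y)^*$.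 *)

(* Defs.v *)
From HB Require Import structures.
From mathcomp Require Import all_boot all_order all_algebra.
From mathcomp Require Import spectral.
From mathcomp Require Import all_classical all_reals all_analysis.
From mathcomp Require Import complex.

Set Implicit Arguments.
Unset Strict Implicit.
Unset Printing Implicit Defensive.

Import Order.TTheory GRing.Theory Num.Theory.
Import numFieldNormedType.Exports.

Local Open Scope ring_scope.
Local Open Scope complex_scope.
Local Open Scope sesquilinear_scope.

(* Throughout, the natural number [N] stands for 2 * ell, so that ell ranges
   over the half-integers as [N] ranges over [nat], and floor(ell) = N./2. *)

(* (a)_i = a (a + 1) ... (a + i - 1) *)
Definition pochhammer (R : realType) (a : R) (i : nat) : R :=
  \prod_(k < i) (a + k%:R).

(* e^(i theta) *)
Definition expi (R : realType) (theta : R) : R[i] := cos theta +i* sin theta.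

Definition Tdiag (R : realType) (N : nat) (nu : R) (i : nat) : R :=
  'C(N, i)%:R * pochhammer nu i / pochhammer (nu + N%:R - i%:R) i.

Definition Tmx (R : realType) (N : nat) (nu : R) : 'M[R[i]]_N.+1 :=
  diag_mx (\row_(i < N.+1)
    (if (i <= N./2)%N then Tdiag N nu i else Tdiag N nu (N - i))%:C).

(* The half-integers j1 = -n/2, ..., n/2 and j2 = -(N-n)/2, ..., (N-n)/2, in
   unit steps, are enumerated by a = j1 + n/2 and b = j2 + (N-n)/2. *)
Definition Phi0 (R : realType) (N : nat) (t : R) : 'M[R[i]]_N.+1 :=
  \matrix_(n < N.+1, m < N.+1)
    \sum_(a < n.+1) \sum_(b < (N - n).+1)
      let j1 : R := - (n%:R / 2) + a%:R in
      let j2 : R := - ((N - n)%:R / 2) + b%:R in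
      (- (N%:R / 2) + m%:R == j1 + j2)%:R
      * 'C(n, a)%:R * 'C(N - n, b)%:R / 'C(N, N - m)%:R
      * expi ((j2 - j1) * t).

Definition Psi0 (R : realType) (N : nat) (y : R) : 'M[R[i]]_N.+1 :=
  Phi0 N (acos (1 - 2 * y)).

Definition Wmx (R : realType) (N : nat) (nu y : R) : 'M[R[i]]_N.+1 :=
  ((1 - y) `^ (nu - 1 / 2) * y `^ (nu - 1 / 2))%:C
    *: (Psi0 N y *m Tmx N nu *m (Psi0 N y) ^t*).

(* Entrywise derivative of a complex matrix-valued function of a real variable;
   the derivative of a complex-valued function is taken on its real and
   imaginary parts. *)
Definition mxderive (R : realType) (m n : nat) (F : R -> 'M[R[i]]_(m, n))
    (y : R) : 'M[R[i]]_(m, n) :=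
  \matrix_(i < m, j < n)
    (derive1 (fun x : R => complex.Re (F x i j)) y
       +i* derive1 (fun x : R => complex.Im (F x i j)) y).

Definition Gamma2 (R : realType) (N : nat) (nu y : R) : 'M[R[i]]_N.+1 :=
  (y * (1 - y))%:C
    *: (invmx ((Psi0 N y) ^t*) *m invmx (Tmx N nu) *m Tmx N (nu + 1)
        *m (Psi0 N y) ^t*).

Definition Gamma1 (R : realType) (N : nat) (nu y : R) : 'M[R[i]]_N.+1 :=
  invmx (Wmx N nu y) *m mxderive (Wmx N (nu + 1)) y.

(* On (0, 1), [F] coincides with a matrix polynomial of degree exactly [d]:
   the polynomial has matrix coefficients, a nonzero coefficient of degree [d],
   and is evaluated at the scalar matrix y * Id. *)
Definition matrix_polynomial_of_degree (R : realType) (N : nat) (d : nat)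
    (F : R -> 'M[R[i]]_N.+1) : Prop :=
  exists P : {poly 'M[R[i]]_N.+1}, size P = d.+1 /\
    forall y : R, 0 < y < 1 -> F y = P.[(y%:C)%:M].

(* Main.v *)
(* Write N = 2 ell, q = e^(it), c = cos t = 1 - 2 y, V = Psi_0(y)^*. Up to a scalar
   and binomial factors, row n of Phi_0(t) lists the coefficients of
   (q + z)^n (1 + q z)^(N - n). Differentiating these generating functions gives,
   for the sl_2 triple acting on homogeneous polynomials of degree N (H diagonal
   with entries i - N/2, L lowering, U raising, Q = L + U, K = L - U - 2 c H) and
   d = q - 1/q,
     Q V = V Q^T,   V K^T = - d H V,   K V = - d V H,
     dPsi_0/dy = Psi_0 (N c - Q^T) / (4 y (1 - y)),   d^2 = - 16 y (1 - y).
   With kappa = nu (nu + N) and b = nu + N/2, the weights satisfy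
     kappa T' = T (b^2 - H^2),
     kappa (Q^T T' + T' Q) = (2 nu + N + 1) T (b Q - H (L - U)),
   where T = T^(nu) and T' = T^(nu+1). Conjugating by V yields
     Gamma_2 = (b^2 y (1 - y) + (K^T)^2 / 16) / kappa,
     Gamma_1 = (nu + (N + 1)/2) / kappa * (c b^2 - (b/2) Q^T + K^T H / 2),
   and K is affine in y. The leading coefficients are multiples of H^2 - b^2,
   whose (0, 0) entry is - kappa. *)
Require Import Defs.
From mathcomp Require Import all_boot all_order all_algebra.
From mathcomp Require Import spectral.
From mathcomp Require Import all_classical all_reals all_analysis.
From mathcomp Require Import complex.
From mathcomp Require Import ring lra zify.
Set Implicit Arguments.
Unset Strict Implicit.
Unset Printing Implicit Defensive.
Import Order.TTheory GRing.Theory Num.Theory.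
Import numFieldNormedType.Exports.
Local Open Scope ring_scope.
Local Open Scope complex_scope.
Local Open Scope sesquilinear_scope.

(** * Tridiagonal matrices of the sl_2 triple *)

Section Tridiagonal.
Variables (F : numFieldType) (N : nat).
Implicit Types (A : 'M[F]_N.+1) (f g : nat -> nat -> F).

Definition lower_mx : 'M[F]_N.+1 :=
  \matrix_(i, j) (i%:R *+ (j.+1 == i :> nat)).

Definition upper_mx : 'M[F]_N.+1 :=
  \matrix_(i, j) ((N%:R - i%:R) *+ (j == i.+1 :> nat)).

Definition weight_mx : 'M[F]_N.+1 :=
  diag_mx (\row_(i < N.+1) (i%:R - N%:R / 2)).

Definition sum_mx := lower_mx + upper_mx.

(* Up to a scalar, [krawt_mx q] conjugates this matrix at [c = (q + q^-1) / 2]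
   to [weight_mx]. *)
Definition Kmx (c : F) := lower_mx - upper_mx - (2 * c) *: weight_mx.

(** At [i = 0] the truncated predecessor [i.-1 = 0] is harmless, since its factor [i%:R]
    vanishes. *)
Lemma sum_pred_ord (i : 'I_N.+1) (G : nat -> F) :
  \sum_(k < N.+1) (i%:R *+ (k.+1 == i :> nat)) * G k = i%:R * G i.-1.
Proof.
case: i => [[|i] hi] /=.
  by rewrite big1 ?mul0r // => k _; rewrite mul0rn mul0r.
rewrite (bigD1 (Ordinal (ltnW hi : (i < N.+1)%N))) //= eqxx mulr1n.
rewrite big1 ?addr0 // => k /eqP nk.
case: eqP => [[e]|_]; last by rewrite mul0r.
by case: nk; apply: val_inj.
Qed.

(** At [i = N] the index [i.+1] leaves the matrix, but its factor [N%:R - i%:R] vanishes; hence [G]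
    may be any function on [nat]. *)
Lemma sum_succ_ord (i : 'I_N.+1) (G : nat -> F) :
  \sum_(k < N.+1) ((N%:R - i%:R) *+ (k == i.+1 :> nat)) * G k
    = (N%:R - i%:R) * G i.+1.
Proof.
case: i => [i hi] /=.
have [iN|iN] := eqVneq i N.
  by rewrite iN subrr big1 ?mul0r // => k _; rewrite mul0rn mul0r.
have hi1 : (i.+1 < N.+1)%N by rewrite ltn_neqAle eqSS iN.
rewrite (bigD1 (Ordinal hi1)) //= eqxx mulr1n.
rewrite big1 ?addr0 // => k /eqP nk.
case: eqP => [e|_]; last by rewrite mul0r.
by case: nk; apply: val_inj.
Qed.

(** Extending the entries of [A] to a function on [nat] lets neighbouring entries be named without
    range proofs. *)
Lemma mul_lower_mx A f (i j : 'I_N.+1) : (forall i j : 'I_N.+1, A i j = f i j) ->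
  (lower_mx *m A) i j = i%:R * f i.-1 j.
Proof.
move=> Af; rewrite mxE -(sum_pred_ord i (fun k => f k j)).
by apply: eq_bigr => k _; rewrite mxE Af.
Qed.

Lemma mul_upper_mx A f (i j : 'I_N.+1) : (forall i j : 'I_N.+1, A i j = f i j) ->
  (upper_mx *m A) i j = (N%:R - i%:R) * f i.+1 j.
Proof.
move=> Af; rewrite mxE -(sum_succ_ord i (fun k => f k j)).
by apply: eq_bigr => k _; rewrite mxE Af.
Qed.

Lemma mul_weight_mx A (i j : 'I_N.+1) :
  (weight_mx *m A) i j = (i%:R - N%:R / 2) * A i j.
Proof. by rewrite mul_diag_mx !mxE. Qed.

Lemma mul_mx_weight A (i j : 'I_N.+1) :
  (A *m weight_mx) i j = (j%:R - N%:R / 2) * A i j.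
Proof. by rewrite mul_mx_diag !mxE mulrC. Qed.

Lemma mul_mx_lowerT A f (i j : 'I_N.+1) : (forall i j : 'I_N.+1, A i j = f i j) ->
  (A *m lower_mx^T) i j = j%:R * f i j.-1.
Proof.
move=> Af; rewrite -[_ *m _]trmxK mxE trmx_mul trmxK.
by rewrite (@mul_lower_mx _ (fun i j => f j i)) // => k l; rewrite mxE.
Qed.

Lemma mul_mx_upperT A f (i j : 'I_N.+1) : (forall i j : 'I_N.+1, A i j = f i j) ->
  (A *m upper_mx^T) i j = (N%:R - j%:R) * f i j.+1.
Proof.
move=> Af; rewrite -[_ *m _]trmxK mxE trmx_mul trmxK.
by rewrite (@mul_upper_mx _ (fun i j => f j i)) // => k l; rewrite mxE.
Qed.

Lemma weight_mxT : weight_mx^T = weight_mx.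
Proof. exact: tr_diag_mx. Qed.

End Tridiagonal.

(** * Linear independence of homogeneous products of two polynomials *)

Section Independence.
Variables (F : fieldType) (p r : {poly F}) (z : F).
Hypotheses (pz : root p z) (rz : r.[z] != 0) (p0 : p != 0).

(* Evaluation at the common root [z] kills every term but the first. *)
Lemma homogeneous_free n (x : nat -> F) :
  \sum_(i < n.+1) (x i)%:P * (p ^+ i * r ^+ (n - i)) = 0 ->
  forall i, (i <= n)%N -> x i = 0.
Proof.
elim: n x => [|n IHn] x; first by rewrite big_ord1 subn0 !expr0 !mulr1 => /eqP;
  rewrite polyC_eq0 => /eqP x0 [|i].
rewrite big_ord_recl subn0 expr0 mul1r => e.
have tailE : \sum_(i < n.+1) (x (lift ord0 i))%:P * (p ^+ lift ord0 i * r ^+ (n.+1 - lift ord0 i))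
    = p * \sum_(i < n.+1) (x i.+1)%:P * (p ^+ i * r ^+ (n - i)).
  by rewrite mulr_sumr; apply: eq_bigr => i _; rewrite /= /bump add1n subSS exprS -!mulrA mulrCA.
rewrite tailE in e.
have x0 : x 0%N = 0.
  move: (congr1 (horner^~ z) e); rewrite /= hornerD !hornerM hornerC horner_exp (rootP pz).
  rewrite mul0r addr0 horner0 => /eqP; rewrite mulf_eq0 expf_eq0 (negPf rz) andbF orbF.
  by move/eqP.
move: e; rewrite [x ord0]x0 mul0r add0r => /eqP; rewrite mulf_eq0 (negPf p0) /= => /eqP.
by move/(IHn (fun i => x i.+1)) => H [|i] //; rewrite ltnS; apply: H.
Qed.
End Independence.

(** * Generating functions of the rows and the resulting matrix identities *)

Section Binomial.
Variables (F : numFieldType) (N : nat) (q : F).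

(* The [n]-th row of [e^(iNt/2) Phi0], up to binomials, lists the coefficients
   of [rowpoly n] at [q = e^(it)]. *)
Definition rowpoly (n : nat) : {poly F} :=
  (q%:P + 'X) ^+ n * (1 + q%:P * 'X) ^+ (N - n).

Definition krawt_mx : 'M[F]_N.+1 :=
  \matrix_(n, m) ((rowpoly n)`_m / 'C(N, m)%:R).

Local Notation u := (q%:P + 'X : {poly F}).
Local Notation v := (1 + q%:P * 'X : {poly F}).
(* [n p / u] and [(N - n) p / v] for [p := rowpoly n]; the identities below are
   linear in these two, hence reduce to identities between [u], [v] and [q]. *)
Let U n : {poly F} := n%:R * (u ^+ n.-1 * v ^+ (N - n)).
Let V n : {poly F} := (N - n)%:R * (u ^+ n * v ^+ (N - n).-1).

Lemma rowpoly_U n : n%:R * rowpoly n = u * U n.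
Proof. by rewrite /U /rowpoly; case: n => [|n]; rewrite ?mul0r ?mulr0 //= exprS; ring. Qed.

Lemma rowpoly_V n : (N - n)%:R * rowpoly n = v * V n.
Proof.
rewrite /V /rowpoly; case: (N - n)%N => [|k]; rewrite ?mul0r ?mulr0 //= exprS; ring.
Qed.

Lemma rowpoly_pred n : (n <= N)%N -> n%:R * rowpoly n.-1 = v * U n.
Proof.
rewrite /U /rowpoly; case: n => [|n] h; rewrite ?mul0r ?mulr0 //=.
by rewrite -(subnSK h) exprS; ring.
Qed.

Lemma rowpoly_succ n : (N - n)%:R * rowpoly n.+1 = u * V n.
Proof.
rewrite /V /rowpoly subnS; case: (N - n)%N => [|k]; rewrite ?mul0r ?mulr0 //=.
by rewrite exprS; ring.
Qed.

Lemma deriv_rowpoly n : (rowpoly n)^`() = U n + q%:P * V n.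
Proof.
rewrite /U /V /rowpoly derivM !deriv_exp !derivD !derivM !derivC !derivX.
by rewrite add0r mul0r !mulr1 add0r; ring.
Qed.

Lemma rowpoly_N n : (n <= N)%N -> N%:R * rowpoly n = u * U n + v * V n.
Proof. by move=> h; rewrite -rowpoly_U -rowpoly_V -mulrDl -natrD subnKC. Qed.

(** On the right stands a differential operator in the indeterminate; read on normalised
    coefficients it is right multiplication by Q^T. *)
Lemma rowpoly_sum n : (n <= N)%N ->
  n%:R * rowpoly n.-1 + (N - n)%:R * rowpoly n.+1 =
  N%:R * ('X * rowpoly n) - 'X * ('X * (rowpoly n)^`()) + (rowpoly n)^`().
Proof.
move=> h; rewrite rowpoly_pred // rowpoly_succ [N%:R * ('X * _)]mulrCA rowpoly_N //.
by rewrite deriv_rowpoly; ring.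
Qed.

(** This is the row form of [K_krawt_mx] multiplied by 2 q, which clears the denominators of c = (q
    + 1/q) / 2 and of q - 1/q; [rowpoly_KT] plays the same part for [krawt_K_mx]. *)
Lemma rowpoly_K n : (n <= N)%N ->
  (2 * q)%:P * (n%:R * rowpoly n.-1 - (N - n)%:R * rowpoly n.+1)
    - (q ^+ 2 + 1)%:P * (n%:R * rowpoly n - (N - n)%:R * rowpoly n) =
  (q ^+ 2 - 1)%:P * (2 * ('X * (rowpoly n)^`()) - N%:R * rowpoly n).
Proof.
move=> h; rewrite rowpoly_pred // rowpoly_succ rowpoly_U rowpoly_V rowpoly_N //.
by rewrite deriv_rowpoly; ring.
Qed.

Lemma rowpoly_KT n : (n <= N)%N ->
  (2 * q)%:P * (N%:R * ('X * rowpoly n) - 'X * ('X * (rowpoly n)^`())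
     - (rowpoly n)^`())
  - (q ^+ 2 + 1)%:P * (2 * ('X * (rowpoly n)^`()) - N%:R * rowpoly n) =
  (q ^+ 2 - 1)%:P * (n%:R * rowpoly n - (N - n)%:R * rowpoly n).
Proof.
move=> h; rewrite [N%:R * ('X * _)]mulrCA rowpoly_U rowpoly_V rowpoly_N //.
by rewrite deriv_rowpoly; ring.
Qed.

(** The derivative of [rowpoly n] in the parameter q, with the indeterminate fixed. *)
Definition dq_rowpoly (n : nat) : {poly F} :=
  n%:R * (u ^+ n.-1 * v ^+ (N - n)) + 'X * ((N - n)%:R * (u ^+ n * v ^+ (N - n).-1)).

Lemma dq_rowpolyE n : (n <= N)%N ->
  (q ^+ 2 - 1)%:P * ((2 * q)%:P * dq_rowpoly n - N%:R * rowpoly n) =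
  (q ^+ 2 + 1)%:P * (N%:R * rowpoly n)
      - (2 * q)%:P * (n%:R * rowpoly n.-1 + (N - n)%:R * rowpoly n.+1).
Proof.
move=> h; rewrite /dq_rowpoly -/(U n) -/(V n) rowpoly_pred // rowpoly_succ rowpoly_N //; ring.
Qed.

Lemma binR_neq0 m : (m <= N)%N -> 'C(N, m)%:R != 0 :> F.
Proof. by move=> h; rewrite pnatr_eq0 -lt0n bin_gt0. Qed.

(** The recursion (m + 1) C(N, m + 1) = (N - m) C(N, m) absorbs the change of binomial normalisation
    between neighbouring coefficients. *)
Lemma coef_lower (p : {poly F}) m : (m <= N)%N ->
  m%:R * (p`_m.-1 / 'C(N, m.-1)%:R) =
  (N%:R * ('X * p) - 'X * ('X * p^`()))`_m / 'C(N, m)%:R.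
Proof.
case: m => [|m] h; first by rewrite !mulr_natl coefB coefMn !coefXM /= mul0rn subrr mul0r.
have -> : (N%:R * ('X * p) - 'X * ('X * p^`()))`_m.+1 = (N - m)%:R * p`_m.
  rewrite mulr_natl coefB coefMn !coefXM /= natrB 1?ltnW //.
  by case: m {h} => [|m]; rewrite /= ?coef_deriv; ring.
have := congr1 (fun x => x%:R : F) (mul_bin_left N m); rewrite !natrM => e.
have c0 := binR_neq0 (ltnW h); have c1 := binR_neq0 h.
have -> : (N - m)%:R = m.+1%:R * 'C(N, m.+1)%:R / 'C(N, m)%:R :> F by rewrite e mulfK.
by rewrite /=; field; rewrite c0 c1.
Qed.

Lemma coef_upper (p : {poly F}) m : (size p <= N.+1)%N -> (m < N.+1)%N ->
  (N%:R - m%:R) * (p`_m.+1 / 'C(N, m.+1)%:R) = (p^`())`_m / 'C(N, m)%:R.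
Proof.
move=> sp h; rewrite coef_deriv -natrB // -[_ *+ m.+1]mulr_natr.
(* At m = N the factor N - m kills the left side, and the size bound kills the coefficient of index
   N + 1 on the right. *)
have [mN|mN] := eqVneq m N.
  by rewrite mN subnn mul0r nth_default ?mN // !mul0r.
have h1 : (m < N)%N by rewrite ltn_neqAle mN.
have := congr1 (fun x => x%:R : F) (mul_bin_left N m); rewrite !natrM => e.
have c0 := binR_neq0 (ltnW h1); have c1 := binR_neq0 h1.
have -> : (N - m)%:R = m.+1%:R * 'C(N, m.+1)%:R / 'C(N, m)%:R :> F by rewrite e mulfK.
by field; rewrite c0 c1.
Qed.

Lemma coef_weight (p : {poly F}) m :
  2 * ((m%:R - N%:R / 2) * (p`_m / 'C(N, m)%:R)) =
  (2 * ('X * p^`()) - N%:R * p)`_m / 'C(N, m)%:R.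
Proof.
have -> : (2 * ('X * p^`()) - N%:R * p)`_m = 2 * (m%:R - N%:R / 2) * p`_m.
  rewrite !mulr_natl coefB !coefMn coefXM.
  by case: m => [|m] /=; rewrite ?coef_deriv; field.
by rewrite !mulrA.
Qed.

Lemma size_rowpoly n : (n <= N)%N -> (size (rowpoly n) <= N.+1)%N.
Proof.
move=> h; have sl (p : {poly F}) k : (size p <= 2)%N -> (size (p ^+ k) <= k.+1)%N.
  move=> sp; apply: leq_trans (size_poly_exp_leq _ _) _; rewrite ltnS.
  by rewrite -[leqRHS]mul1n leq_mul2r -subn1 leq_subLR sp orbT.
apply: leq_trans (size_polyMleq _ _) _.
have su : (size u <= 2)%N by rewrite addrC size_XaddC.
have sv : (size v <= 2)%N.
  rewrite (leq_trans (size_polyD _ _)) // geq_max size_poly1 mul_polyC.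
  by rewrite (leq_trans (size_scale_leq _ _)) // size_polyX.
have := leq_add (sl _ n su) (sl _ (N - n)%N sv).
by rewrite addSn addnS subnKC // -subn1 leq_subLR add1n.
Qed.

Let f n m : F := (rowpoly n)`_m / 'C(N, m)%:R.
Local Notation Kr := krawt_mx.

Lemma krawt_mxE (i j : 'I_N.+1) : Kr i j = f i j.
Proof. by rewrite mxE. Qed.

Lemma coef_natM k (p : {poly F}) m : (k%:R * p)`_m = k%:R * p`_m.
Proof. by rewrite !mulr_natl coefMn. Qed.

Lemma mul_lower_krawt (i j : 'I_N.+1) :
  (lower_mx F N *m Kr) i j = (i%:R * rowpoly i.-1)`_j / 'C(N, j)%:R.
Proof. by rewrite (mul_lower_mx _ _ krawt_mxE) /f coef_natM mulrA. Qed.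

Lemma mul_upper_krawt (i j : 'I_N.+1) :
  (upper_mx F N *m Kr) i j = ((N - i)%:R * rowpoly i.+1)`_j / 'C(N, j)%:R.
Proof.
rewrite (mul_upper_mx _ _ krawt_mxE) /f -natrB -1?ltnS //.
by rewrite coef_natM mulrA.
Qed.

Lemma mul_weight_krawt (i j : 'I_N.+1) :
  2 * (weight_mx F N *m Kr) i j =
  (i%:R * rowpoly i - (N - i)%:R * rowpoly i)`_j / 'C(N, j)%:R.
Proof.
rewrite mul_weight_mx krawt_mxE /f coefB !coef_natM natrB -1?ltnS //.
by field; apply: binR_neq0; rewrite -ltnS.
Qed.

Lemma krawt_mul_lowerT (i j : 'I_N.+1) :
  (Kr *m (lower_mx F N)^T) i j =
  (N%:R * ('X * rowpoly i) - 'X * ('X * (rowpoly i)^`()))`_j / 'C(N, j)%:R.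
Proof. by rewrite (mul_mx_lowerT _ _ krawt_mxE) /f coef_lower // -ltnS. Qed.

Lemma krawt_mul_upperT (i j : 'I_N.+1) :
  (Kr *m (upper_mx F N)^T) i j = (rowpoly i)^`()`_j / 'C(N, j)%:R.
Proof.
by rewrite (mul_mx_upperT _ _ krawt_mxE) /f coef_upper // size_rowpoly // -ltnS.
Qed.

Lemma krawt_mul_weight (i j : 'I_N.+1) :
  2 * (Kr *m weight_mx F N) i j =
  (2 * ('X * (rowpoly i)^`()) - N%:R * rowpoly i)`_j / 'C(N, j)%:R.
Proof. by rewrite mul_mx_weight krawt_mxE /f coef_weight. Qed.

Lemma mul_sum_krawt (i j : 'I_N.+1) : (sum_mx F N *m Kr) i j =
  (i%:R * rowpoly i.-1 + (N - i)%:R * rowpoly i.+1)`_j / 'C(N, j)%:R.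
Proof.
by rewrite /sum_mx mulmxDl [LHS]mxE mul_lower_krawt mul_upper_krawt coefD mulrDl.
Qed.

Lemma sum_krawt_mx : sum_mx F N *m Kr = Kr *m (sum_mx F N)^T.
Proof.
apply/matrixP => i j; rewrite /sum_mx [_^T]raddfD /= mulmxDl mulmxDr [LHS]mxE [RHS]mxE.
rewrite mul_lower_krawt mul_upper_krawt krawt_mul_lowerT krawt_mul_upperT -!mulrDl -!coefD.
by rewrite rowpoly_sum // -ltnS.
Qed.

Hypothesis q0 : q != 0.
Let c := (q + q^-1) / 2.

Lemma two_q_unit : 2 * q != 0.
Proof. by rewrite mulf_neq0 // pnatr_eq0. Qed.

Lemma K_krawt_mx : Kmx N c *m Kr = (q - q^-1) *: (Kr *m weight_mx F N).
Proof.
apply/matrixP => i j; apply: (mulfI two_q_unit).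
have hi : (i <= N)%N by rewrite -ltnS.
have := congr1 (fun p : {poly F} => p`_j / 'C(N, j)%:R) (rowpoly_K hi).
rewrite !(coefB, coefCM) mulrBl -!mulrA mulrBl -mul_lower_krawt -mul_upper_krawt.
rewrite -2!coefB -mul_weight_krawt -krawt_mul_weight => e.
have -> : (Kmx N c *m Kr) i j = (lower_mx F N *m Kr) i j - (upper_mx F N *m Kr) i j
    - 2 * c * (weight_mx F N *m Kr) i j.
  rewrite /Kmx !mulmxBl -scalemxAl.
  by move: (lower_mx F N *m _) (upper_mx F N *m _) (weight_mx F N *m _) => X Y Z; rewrite !mxE.
rewrite [in RHS]mxE /c; move: e.
set x := _ i j; set y := _ i j; set z := _ i j; set w := _ i j => e.
rewrite !mulrBr; apply: (mulfI q0); transitivity (q * ((q ^+ 2 - 1) * (2 * w))); last by field.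
by rewrite -e; field.
Qed.

Lemma krawt_K_mx : Kr *m (Kmx N c)^T = (q - q^-1) *: (weight_mx F N *m Kr).
Proof.
apply/matrixP => i j; apply: (mulfI two_q_unit).
have hi : (i <= N)%N by rewrite -ltnS.
have := congr1 (fun p : {poly F} => p`_j / 'C(N, j)%:R) (rowpoly_KT hi).
rewrite coefB !coefCM coefB mulrBl -!mulrA mulrBl -krawt_mul_lowerT -krawt_mul_upperT.
rewrite -krawt_mul_weight -mul_weight_krawt => e.
have -> : (Kr *m (Kmx N c)^T) i j =
   (Kr *m (lower_mx F N)^T) i j - (Kr *m (upper_mx F N)^T) i j
    - 2 * c * (Kr *m weight_mx F N) i j.
  have -> : (Kmx N c)^T = (lower_mx F N)^T - (upper_mx F N)^T - (2 * c) *: weight_mx F N.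
    by rewrite -[in RHS]weight_mxT; apply/matrixP=> k l; rewrite !mxE.
  rewrite !mulmxBr -scalemxAr.
  by move: (Kr *m _) (Kr *m _) (Kr *m _) => X Y Z; rewrite !mxE.
rewrite [in RHS]mxE /c; move: e.
set x := _ i j; set y := _ i j; set z := _ i j; set w := _ i j => e.
rewrite !mulrBr; apply: (mulfI q0); transitivity (q * ((q ^+ 2 - 1) * (2 * w))); last by field.
by rewrite -e; field.
Qed.

Definition dq_krawt_mx : 'M[F]_N.+1 :=
  \matrix_(n, m) ((dq_rowpoly n)`_m / 'C(N, m)%:R).

(** The term with N / 2 comes from the prefactor q^(-N/2) of Phi_0: q d/dq of q^(-N/2) [Kr] is
    q^(-N/2) times the bracket on the left. *)
Lemma dq_krawt_mxE :
  (q - q^-1) *: (q *: dq_krawt_mx - (N%:R / 2) *: Kr) = (c * N%:R) *: Kr - sum_mx F N *m Kr.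
Proof.
apply/matrixP => i j; apply: (mulfI two_q_unit).
have hi : (i <= N)%N by rewrite -ltnS.
have Cj0 : 'C(N, j)%:R != 0 :> F by rewrite binR_neq0 // -ltnS.
have := congr1 (fun p : {poly F} => p`_j / 'C(N, j)%:R) (dq_rowpolyE hi).
rewrite /= coefCM !coefB !coefCM !coef_natM.
have dqE : (dq_rowpoly i)`_j = dq_krawt_mx i j * 'C(N, j)%:R by rewrite mxE divfK.
have KrE : (rowpoly i)`_j = Kr i j * 'C(N, j)%:R by rewrite mxE divfK.
have sE := mul_sum_krawt i j.
have {sE} -> : (i%:R * rowpoly i.-1 + (N - i)%:R * rowpoly i.+1)`_j =
  (sum_mx F N *m Kr) i j * 'C(N, j)%:R by rewrite sE divfK.
rewrite dqE KrE; move: (sum_mx F N *m Kr) dq_krawt_mx Kr => X Y Z; rewrite !mxE /c => e.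
apply: (mulfI q0); transitivity ((q ^+ 2 - 1) *
      (2 * q * (Y i j * 'C(N, j)%:R) - N%:R * (Z i j * 'C(N, j)%:R)) / 'C(N, j)%:R * q).
  by field; rewrite Cj0.
by rewrite e; field; rewrite q0 Cj0.
Qed.

Hypothesis q2 : q ^+ 2 != 1.

(** A linear relation between the rows is a homogeneous relation between [u] and [v]. Now [u]
    vanishes at -q, where [v] takes the nonzero value 1 - q^2, so [homogeneous_free] applies. *)
Lemma krawt_unitmx : Kr \in unitmx.
Proof.
rewrite -row_free_unit; apply: inj_row_free => w wK.
(* The row vector is extended by 0 to the coefficient sequence on [nat] expected by
   [homogeneous_free]. *)
pose x k : F := if insub k is Some i then w 0 (i : 'I_N.+1) else 0.
have xE (i : 'I_N.+1) : x i = w 0 i by rewrite /x valK.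
suff x0 : forall i, (i <= N)%N -> x i = 0.
  by apply/rowP => i; rewrite -xE x0 ?mxE // -ltnS.
apply: (@homogeneous_free _ u v (- q)).
- by rewrite rootE !hornerE addrN.
- by rewrite !hornerE mulrN -expr2 subr_eq0 eq_sym.
- by rewrite -size_poly_gt0 addrC size_XaddC.
(* Coefficients above N vanish by degree; the others are the entries of [w *m Kr], up to a nonzero
   binomial. *)
apply/polyP => j; rewrite coef0 coef_sum; have [jN|jN] := leqP N.+1 j.
  rewrite big1 // => i _; rewrite coefCM -/(rowpoly i) nth_default ?mulr0 //.
  by apply: leq_trans jN; rewrite size_rowpoly // -ltnS.
move/matrixP: wK => /(_ 0 (Ordinal jN)); rewrite !mxE => e.
apply: (mulIf (invr_neq0 (binR_neq0 (m := j) jN))); rewrite mul0r -[RHS]e mulr_suml.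
by apply: eq_bigr => i _; rewrite coefCM xE mxE mulrA.
Qed.

End Binomial.

(* With [c = 1 - 2 y], this is [M] in [(W^(nu+1))' = w Psi0 M Psi0^*]. *)
Definition log_derivative_mx (F : numFieldType) (N : nat) (nu c : F)
    (T : 'M[F]_N.+1) : 'M[F]_N.+1 :=
  ((nu + 1 / 2) * c) *: T
    + 4^-1 *: (((N%:R * c)%:M - (sum_mx F N)^T) *m T + T *m ((N%:R * c)%:M - sum_mx F N)).

(** * Conjugation of the weights by V, from the intertwining relations alone *)

Section Conjugation.
Variables (F : numFieldType) (N : nat) (nu : F) (t t' : nat -> F).
(* [t] and [t'] stand for the diagonals of [T^(nu)] and [T^(nu+1)]. *)
Hypotheses (nu_gt0 : 0 < nu)
  (t_succ : forall m, (m < N)%N ->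
     m.+1%:R * (nu + N%:R - m.+1%:R) * t m.+1 = (N%:R - m%:R) * (nu + m%:R) * t m)
  (t_shift : forall m, (m <= N)%N ->
     nu * (nu + N%:R) * t' m = (nu + m%:R) * (nu + N%:R - m%:R) * t m)
  (t_neq0 : forall m, (m <= N)%N -> t m != 0).

Local Notation H := (weight_mx F N).
Local Notation Q := (sum_mx F N).
Let T : 'M[F]_N.+1 := diag_mx (\row_(i < N.+1) t i).
Let T' : 'M[F]_N.+1 := diag_mx (\row_(i < N.+1) t' i).
Let kappa := nu * (nu + N%:R).
Let b := nu + N%:R / 2.

(** With h = m - N/2, the factors in [t_shift] are nu + m = b + h and nu + N - m = b - h. *)
Lemma diag_shift : kappa *: T' = T *m ((b ^+ 2)%:M - H *m H).
Proof.
apply/matrixP => i j; rewrite mul_diag_mx mul_diag_mx !mxE.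
case: eqVneq => [->|_]; last by rewrite !mulr0n !mulr0 subr0 mulr0.
by rewrite !mulr1n t_shift -1?ltnS // /b; field.
Qed.

(** Both sides live on the two off-diagonals. There [t_shift] removes [t'], and [t_succ] expresses
    the neighbouring weight through [t i]. *)
Lemma diag_sum : kappa *: (Q^T *m T' + T' *m Q) =
  (2 * nu + N%:R + 1) *: (T *m (b *: Q - H *m (lower_mx F N - upper_mx F N))).
Proof.
apply/matrixP => i j.
rewrite [LHS]mxE [X in kappa * X]mxE [RHS]mxE !mul_diag_mx mul_mx_diag !mxE.
have iN : (i <= N)%N by rewrite -ltnS.
have jN : (j <= N)%N by rewrite -ltnS.
rewrite mulrDr [in kappa * (_ * t' j)]mulrCA [kappa * (t' i * _)]mulrA t_shift //.
rewrite t_shift //.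
have [ij|nij] := eqVneq (i.+1) j.
  have -> : (j.+1 == i :> nat) = false by lia.
  have -> : (i == j.+1 :> nat) = false by lia.
  move: (t_succ (m := i)); rewrite ij => /(_ jN); rewrite -ij /b => e.
  rewrite ?eqxx !mulr0n !mulr1n.
  transitivity ((nu + i.+1%:R) * (i.+1%:R * (nu + N%:R - i.+1%:R) * t i.+1) +
     (nu + i%:R) * (nu + N%:R - i%:R) * t i * (N%:R - i%:R)); first by ring.
  by rewrite e -natr1; field.
have [ji|nji] := eqVneq (j.+1) i.
  move: (t_succ (m := j)); rewrite ji => /(_ iN); rewrite -ji /b => e.
  rewrite !mulr0n !mulr1n.
  transitivity ((nu + N%:R - j%:R) * ((N%:R - j%:R) * (nu + j%:R) * t j) +
     (nu + j.+1%:R) * (nu + N%:R - j.+1%:R) * t j.+1 * j.+1%:R); first by ring.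
  by rewrite -e -natr1; field.
by rewrite !mulr0n; ring.
Qed.

Lemma diag_unitmx : T \in unitmx.
Proof.
rewrite unitmxE det_diag unitfE; apply/prodf_neq0 => i _.
by rewrite mxE t_neq0 // -ltnS.
Qed.

Lemma kappa_neq0 : kappa != 0.
Proof. by rewrite mulf_neq0 ?lt0r_neq0 // ltr_pwDl. Qed.

Variables (V : 'M[F]_N.+1) (c delta : F).
Hypotheses (V_unit : V \in unitmx) (delta_neq0 : delta != 0)
  (QV : Q *m V = V *m Q^T)
  (VK : V *m (Kmx N c)^T = - delta *: (H *m V))
  (KV : Kmx N c *m V = - delta *: (V *m H)).

Lemma weight2_conj : H *m H *m V = delta ^- 2 *: (V *m ((Kmx N c)^T *m (Kmx N c)^T)).
Proof.
rewrite mulmxA VK -scalemxAl -[H *m V *m _]mulmxA VK -scalemxAr scalerA scalerA.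
by rewrite -mulrA mulrNN -expr2 mulVf ?expf_neq0 // scale1r mulmxA.
Qed.

(** Both sides equal -[delta] times H V H, by [KV] on the left and [VK] on the right. *)
Lemma weightK_conj : H *m Kmx N c *m V = V *m ((Kmx N c)^T *m H).
Proof. by rewrite -mulmxA KV -scalemxAr [RHS]mulmxA VK -scalemxAl mulmxA. Qed.

(** By [diag_shift], T^-1 T' is a polynomial in H^2, and conjugation by V turns H^2 into a multiple
    of (K^T)^2. *)
Lemma conj_shift :
  invmx V *m invmx T *m T' *m V =
  kappa^-1 *: ((b ^+ 2)%:M - delta ^- 2 *: ((Kmx N c)^T *m (Kmx N c)^T)).
Proof.
have -> : T' = kappa^-1 *: (T *m ((b ^+ 2)%:M - H *m H)).
  by rewrite -diag_shift scalerA mulVf ?scale1r ?kappa_neq0.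
rewrite -scalemxAr -scalemxAl; congr (_ *: _).
rewrite -[_ *m (T *m _)]mulmxA mulKmx ?diag_unitmx // -mulmxA; apply: (canLR (mulKmx V_unit)).
by rewrite mulmxBl weight2_conj mulmxBr -scalemxAr mul_scalar_mx mul_mx_scalar.
Qed.

Lemma conj_derivative :
  invmx V *m invmx T *m log_derivative_mx nu c T' *m V =
  ((nu + (N%:R + 1) / 2) / kappa) *:
    ((c * b ^+ 2)%:M - (b / 2) *: Q^T + 2^-1 *: ((Kmx N c)^T *m H)).
Proof.
set M := log_derivative_mx _ _ _; set s := nu + (N%:R + 1) / 2.
have -> : M = (s / kappa) *: (T *m ((c * b ^+ 2)%:M - (b / 2) *: Q + 2^-1 *: (H *m Kmx N c))).
  (* The scalar parts N c of the two brackets join the first term: (nu + 1/2) c + N c / 2 = s c. *)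
  have -> : M = (s / kappa) *: (c *: (kappa *: T')) - (4 * kappa)^-1 *: (kappa *: (Q^T *m T' + T' *m Q)).
    rewrite /M /log_derivative_mx mulmxBl mulmxBr mul_scalar_mx mul_mx_scalar !scalerA.
    have k0 := kappa_neq0.
    apply/matrixP => i j; move: (_ *m T') (T' *m _) => X Y; rewrite !mxE /s.
    by field.
  rewrite diag_shift diag_sum.
  (* With L - U written as K + 2 c H, the H^2 terms coming from [diag_shift] and [diag_sum] cancel;
     only H K remains, which [weightK_conj] handles. *)
  have -> : lower_mx F N - upper_mx F N = Kmx N c + (2 * c) *: H by rewrite subrK.
  have k0 := kappa_neq0.
  rewrite [H *m (_ + _)]mulmxDr !scalemxAr -mulmxBr; congr (T *m _).
  apply/matrixP => i j; rewrite -!scalemxAr; move: (H *m H) (H *m Kmx N c) => X Y; rewrite !mxE /s.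
  by case: (i == j); rewrite ?mulr1n ?mulr0n; field.
rewrite -scalemxAr -scalemxAl; congr (_ *: _).
rewrite -[_ *m (T *m _)]mulmxA mulKmx ?diag_unitmx // -mulmxA; apply: (canLR (mulKmx V_unit)).
rewrite mulmxDl mulmxBl [V *m _]mulmxDr [V *m _]mulmxBr -!scalemxAl -!scalemxAr QV weightK_conj.
by rewrite mul_scalar_mx mul_mx_scalar.
Qed.

End Conjugation.

(** * Pochhammer symbols and the diagonal of T *)

Section Weights.
Variables (R : realType) (N : nat).
Implicit Type nu : R.

(** A closed form of the diagonal of T, visibly symmetric under i -> N - i, which removes the case
    split at floor(ell). *)
Definition Tcoef nu (i : nat) : R :=
  'C(N, i)%:R * pochhammer nu i * pochhammer nu (N - i) / pochhammer nu N.

Lemma pochhammer_gt0 nu i : 0 < nu -> 0 < pochhammer nu i.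
Proof. by move=> n0; apply: prodr_gt0 => k _; rewrite ltr_wpDr. Qed.

Lemma pochhammerS nu i : pochhammer nu i.+1 = pochhammer nu i * (nu + i%:R).
Proof. exact: big_ord_recr. Qed.

Lemma pochhammerD nu i j :
  pochhammer nu (i + j) = pochhammer nu i * pochhammer (nu + i%:R) j.
Proof.
elim: j => [|j IH]; first by rewrite addn0 [pochhammer _ 0]big_ord0 mulr1.
by rewrite addnS !pochhammerS IH natrD !mulrA addrA.
Qed.

Lemma pochhammer_shift nu i : nu * pochhammer (nu + 1) i = pochhammer nu i * (nu + i%:R).
Proof.
by rewrite -pochhammerS -add1n pochhammerD [pochhammer _ 1]big_ord1 addr0.
Qed.

Lemma Tcoef_gt0 nu i : 0 < nu -> (i <= N)%N -> 0 < Tcoef nu i.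
Proof.
by move=> n0 iN; rewrite divr_gt0 ?mulr_gt0 ?pochhammer_gt0 // ltr0n bin_gt0.
Qed.

(** Split (nu)_N as (nu)_(N-i) (nu + N - i)_i. *)
Lemma TdiagE nu i : 0 < nu -> (i <= N)%N -> Tdiag N nu i = Tcoef nu i.
Proof.
move=> n0 iN; rewrite /Tdiag /Tcoef.
have -> : nu + N%:R - i%:R = nu + (N - i)%:R by rewrite natrB // addrA.
have p1 := lt0r_neq0 (pochhammer_gt0 (N - i) n0).
have p2 : pochhammer (nu + (N - i)%:R) i != 0.
  by rewrite lt0r_neq0 // pochhammer_gt0 // ltr_wpDr.
by rewrite -[in pochhammer nu N](subnK iN) pochhammerD; field; rewrite p1 p2.
Qed.

Lemma Tcoef_sym nu i : (i <= N)%N -> Tcoef nu (N - i) = Tcoef nu i.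
Proof. by move=> iN; rewrite /Tcoef bin_sub // subKn //; congr (_ / _); rewrite mulrAC. Qed.

Lemma Tcoef_succ nu m : 0 < nu -> (m < N)%N ->
  m.+1%:R * (nu + N%:R - m.+1%:R) * Tcoef nu m.+1 =
  (N%:R - m%:R) * (nu + m%:R) * Tcoef nu m.
Proof.
move=> n0 mN; rewrite /Tcoef -[(N - m)%N](subnSK mN) !pochhammerS natrB // addrA.
have := congr1 (fun x => x%:R : R) (mul_bin_left N m); rewrite !natrM natrB 1?ltnW // => e.
have p1 := lt0r_neq0 (pochhammer_gt0 N n0).
transitivity ((m.+1%:R * 'C(N, m.+1)%:R) * (nu + N%:R - m.+1%:R) * (pochhammer nu m * (nu + m%:R)) *
   pochhammer nu (N - m.+1) / pochhammer nu N); first by field.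
by rewrite e; field.
Qed.

(** Apply nu (nu + 1)_i = (nu)_i (nu + i) at i = m, N - m and N. *)
Lemma Tcoef_shift nu m : 0 < nu -> (m <= N)%N ->
  nu * (nu + N%:R) * Tcoef (nu + 1) m = (nu + m%:R) * (nu + N%:R - m%:R) * Tcoef nu m.
Proof.
move=> n0 mN; rewrite /Tcoef.
have p1 := lt0r_neq0 (pochhammer_gt0 N n0); have n1 := lt0r_neq0 n0.
have n2 : nu + N%:R != 0 by rewrite lt0r_neq0 // ltr_wpDr.
have sh i : pochhammer (nu + 1) i = pochhammer nu i * (nu + i%:R) / nu.
  by rewrite -pochhammer_shift mulrC mulKf.
by rewrite !sh natrB //; field; rewrite p1 n2 n1.
Qed.

Lemma TmxE nu : 0 < nu -> Tmx N nu = diag_mx (\row_(i < N.+1) (Tcoef nu i)%:C).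
Proof.
move=> n0; congr diag_mx; apply/rowP => i; rewrite !mxE.
have iN : (i <= N)%N by rewrite -ltnS.
by case: ifP => _; rewrite TdiagE ?leq_subr // Tcoef_sym.
Qed.

End Weights.

(** * Complex exponentials and the factorisation of Phi_0 *)

Section Fourier.
Variables (R : realType) (N : nat).

Lemma expiD (x y : R) : expi (x + y) = expi x * expi y.
Proof.
by rewrite /expi cosD sinD; apply/eqP; rewrite eq_complex /= eqxx addrC eqxx.
Qed.

Lemma expi0 : expi (0 : R) = 1.
Proof. by rewrite /expi cos0 sin0. Qed.

Lemma expiMn (x : R) n : expi (n%:R * x) = expi x ^+ n.
Proof.
elim: n => [|n IH]; first by rewrite mul0r expi0 expr0.
by rewrite -natr1 mulrDl mul1r expiD IH exprSr.
Qed.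

Lemma expi_neq0 (x : R) : expi x != 0.
Proof.
apply/eqP => e; have := expiD x (- x); rewrite subrr expi0 e mul0r => /eqP.
by rewrite oner_eq0.
Qed.

Lemma expiV (x : R) : (expi x)^-1 = expi (- x).
Proof.
by apply: (mulIf (expi_neq0 x)); rewrite mulVf ?expi_neq0 // -expiD addNr expi0.
Qed.

(** Expand both powers in [rowpoly]. The Kronecker condition on half-integers becomes m = a + b, and
    j2 - j1 = -N/2 + (n - a) + b splits the exponential. *)
Lemma Phi0E (t : R) :
  Phi0 N t = expi (- (N%:R / 2) * t) *: krawt_mx N (expi t).
Proof.
set q := expi t; apply/matrixP => n m; rewrite !mxE /rowpoly.
have nN : (n <= N)%N by rewrite -ltnS.
have mN : (m <= N)%N by rewrite -ltnS.
rewrite !exprDn big_distrlr /= coef_sum mulr_suml mulr_sumr.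
apply: eq_bigr => a _; rewrite coef_sum mulr_suml mulr_sumr; apply: eq_bigr => b _.
have aN : (a <= n)%N by rewrite -ltnS.
have -> : q%:P ^+ (n - a) * 'X^a *+ 'C(n, a) * (1 ^+ (N - n - b) * (q%:P * 'X) ^+ b *+ 'C(N - n, b))
    = (q ^+ (n - a) * q ^+ b * 'C(n, a)%:R * 'C(N - n, b)%:R)%:P * 'X^(a + b).
  rewrite expr1n mul1r exprMn -!rmorphXn /= -[_ *+ 'C(n, a)]mulr_natr.
  by rewrite -[_ *+ 'C(N - n, b)]mulr_natr exprD !polyCM !polyC_natr; ring.
rewrite coefCM coefXn.
rewrite bin_sub //.
have -> : (- (N%:R / 2) + m%:R == - (n%:R / 2) + a%:R + (- ((N - n)%:R / 2) + b%:R) :> R)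
    = (m == a + b :> nat)%N.
  rewrite -[RHS](eqr_nat R) -[LHS]subr_eq0 -[RHS]subr_eq0 natrD natrB //; congr (_ == 0).
  by field.
case: eqP => _; last by rewrite !mul0r mulr0 mul0r mulr0.
have -> : (- ((N - n)%:R / 2) + b%:R - (- (n%:R / 2) + a%:R)) * t =
    - (N%:R / 2) * t + ((n - a)%:R * t + b%:R * t).
  by rewrite !natrB //; field.
by rewrite !expiD !expiMn; ring.
Qed.

Lemma conj_expi (x : R) : Num.conj (expi x) = expi (- x).
Proof. by rewrite /expi cosN sinN. Qed.

End Fourier.

(** * Conjugate transposes of the real tridiagonal matrices *)

Section Adjoint.
Variables (C : numClosedFieldType).

Lemma adjmxM m n p (A : 'M[C]_(m, n)) (B : 'M[C]_(n, p)) :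
  (A *m B) ^t* = B ^t* *m A ^t*.
Proof. by rewrite trmx_mul map_mxM. Qed.

Lemma adjmxZ m n a (A : 'M[C]_(m, n)) : (a *: A) ^t* = Num.conj a *: A ^t*.
Proof. by rewrite [(a *: A)^T]linearZ map_mxZ. Qed.

Variables (N : nat) (c : C) (c_real : Num.conj c = c).

Lemma adj_weight_mx : (weight_mx C N) ^t* = weight_mx C N.
Proof.
apply/matrixP => i j; rewrite weight_mxT !mxE; apply/CrealP.
by rewrite rpredMn // rpredB ?rpredM ?rpredV ?rpred_nat.
Qed.

Lemma adj_sum_mx : (sum_mx C N) ^t* = (sum_mx C N)^T.
Proof.
apply/matrixP => i j; rewrite !mxE; apply/CrealP.
by rewrite rpredD ?rpredMn ?rpredB ?rpred_nat ?rpred1.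
Qed.

Lemma adj_Kmx : (Kmx N c) ^t* = (Kmx N c)^T.
Proof.
apply/matrixP => i j; rewrite !mxE; apply/CrealP.
rewrite rpredB ?rpredM ?rpredB ?rpredMn ?rpredB ?rpredM ?rpredV ?rpred_nat ?rpred1 //.
exact/CrealP.
Qed.

End Adjoint.

(** * Intertwining relations for the adjoint of Phi_0 *)

Section Psi.
Variables (R : realType) (N : nat) (t : R).
Hypothesis st : sin t != 0.
Local Notation C := R[i].
Let V : 'M[C]_N.+1 := (Phi0 N t) ^t*.
Let q := expi t.
Let c : C := (cos t)%:C.
Let delta : C := q - q^-1.

Lemma expi_sub : delta = 2 * 'i%C * (sin t)%:C.
Proof.
rewrite /delta /q expiV /expi cosN sinN; apply/eqP; rewrite eq_complex /=.
by apply/andP; split; apply/eqP; ring.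
Qed.

Lemma expi_add : (q + q^-1) / 2 = c.
Proof.
apply: (mulIf (_ : 2 != 0)); first by rewrite pnatr_eq0.
rewrite divfK ?pnatr_eq0 // /q expiV /expi cosN sinN; apply/eqP; rewrite eq_complex /=.
by apply/andP; split; apply/eqP; ring.
Qed.

Lemma delta_neq0 : delta != 0.
Proof.
rewrite expi_sub; rewrite !mulf_neq0 ?pnatr_eq0 //; rewrite eq_complex /= ?oner_eq0 ?andbF //.
by rewrite (negPf st).
Qed.

Lemma conj_delta : Num.conj delta = - delta.
Proof. by rewrite /delta /q expiV rmorphB /= !conj_expi opprK opprB. Qed.

Lemma expi_sqr_neq1 : q ^+ 2 != 1.
Proof.
have q0 := expi_neq0 t; apply: contra delta_neq0 => /eqP e.
by rewrite /delta subr_eq0 -(inj_eq (mulfI q0)) mulfV // -expr2 e.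
Qed.

Lemma V_unit : V \in unitmx.
Proof.
rewrite /V Phi0E adjmxZ conj_expi unitmxZ ?unitfE ?expi_neq0 //.
by rewrite map_unitmx unitmx_tr krawt_unitmx // ?expi_neq0 // expi_sqr_neq1.
Qed.

Lemma sum_V : sum_mx C N *m V = V *m (sum_mx C N)^T.
Proof.
have -> : (sum_mx C N)^T = (sum_mx C N) ^t* by rewrite adj_sum_mx.
rewrite -adjmxM; have -> : sum_mx C N *m V = (Phi0 N t *m (sum_mx C N)^T) ^t*.
  by rewrite adjmxM -adj_sum_mx trmxCK.
by rewrite Phi0E -scalemxAr -scalemxAl sum_krawt_mx.
Qed.

(** The adjoint of [K_krawt_mx]. The minus sign appears because [delta] is purely imaginary; [K_V]
    is likewise the adjoint of [krawt_K_mx]. *)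
Lemma V_K : V *m (Kmx N c)^T = - delta *: (weight_mx C N *m V).
Proof.
have cr : Num.conj c = c by exact: conjc_real.
rewrite -adj_Kmx // -adjmxM {1}Phi0E -scalemxAr -expi_add.
rewrite K_krawt_mx ?expi_neq0 // -/q -/delta scalerA mulrC -scalerA adjmxZ conj_delta.
by rewrite scalemxAl -Phi0E adjmxM adj_weight_mx.
Qed.

Lemma K_V : Kmx N c *m V = - delta *: (V *m weight_mx C N).
Proof.
have cr : Num.conj c = c by exact: conjc_real.
have -> : Kmx N c = ((Kmx N c)^T) ^t*.
  by rewrite -adj_Kmx // trmxCK.
rewrite -adjmxM {1}Phi0E -scalemxAl -expi_add.
rewrite krawt_K_mx ?expi_neq0 // -/q -/delta scalerA mulrC -scalerA adjmxZ conj_delta.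
by rewrite scalemxAr -Phi0E adjmxM adj_weight_mx.
Qed.

End Psi.

(** * Differential calculus for complex, polynomial and matrix values *)

Section ComplexDerivative.
Variable R : realType.
Local Notation C := R[i].
Implicit Types (f g : R -> C) (x : R) (a b : C).

(** Unlike the bare value in [mxderive], this also records differentiability, which the sum, product
    and chain rules require. *)
Definition has_cderive f x a :=
  is_derive x 1 (fun y => complex.Re (f y)) (complex.Re a) /\
  is_derive x 1 (fun y => complex.Im (f y)) (complex.Im a).

Lemma has_cderive_eq f x a b : has_cderive f x a -> a = b -> has_cderive f x b.
Proof. by move=> h <-. Qed.

Lemma has_cderive_cst x a : has_cderive (fun=> a) x 0.
Proof. by split; apply: is_derive_cst. Qed.

Lemma ReD a b : complex.Re (a + b) = complex.Re a + complex.Re b.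
Proof. by case: a; case: b. Qed.

Lemma ImD a b : complex.Im (a + b) = complex.Im a + complex.Im b.
Proof. by case: a; case: b. Qed.

Lemma ReM a b : complex.Re (a * b) =
  complex.Re a * complex.Re b - complex.Im a * complex.Im b.
Proof. by case: a; case: b. Qed.

Lemma ImM a b : complex.Im (a * b) =
  complex.Re a * complex.Im b + complex.Im a * complex.Re b.
Proof. by case: a; case: b. Qed.

Lemma has_cderiveD f g x a b : has_cderive f x a -> has_cderive g x b ->
  has_cderive (fun y => f y + g y) x (a + b).
Proof.
move=> [f1 f2] [g1 g2]; split.
  have -> : (fun y => complex.Re (f y + g y)) =
      (fun y => complex.Re (f y)) + (fun y => complex.Re (g y)).
    by apply/funext => y; rewrite ReD.
  by apply: (is_derive_eq (is_deriveD f1 g1)); rewrite ReD.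
have -> : (fun y => complex.Im (f y + g y)) =
    (fun y => complex.Im (f y)) + (fun y => complex.Im (g y)).
  by apply/funext => y; rewrite ImD.
by apply: (is_derive_eq (is_deriveD f2 g2)); rewrite ImD.
Qed.

Lemma has_cderiveM f g x a b : has_cderive f x a -> has_cderive g x b ->
  has_cderive (fun y => f y * g y) x (a * g x + f x * b).
Proof.
move=> [f1 f2] [g1 g2]; split.
  have -> : (fun y => complex.Re (f y * g y)) =
      (fun y => complex.Re (f y)) * (fun y => complex.Re (g y)) -
      (fun y => complex.Im (f y)) * (fun y => complex.Im (g y)).
    by apply/funext => y; rewrite ReM.
  apply: (is_derive_eq (is_deriveB (is_deriveM f1 g1) (is_deriveM f2 g2))).
  by rewrite ReD !ReM /GRing.scale /=; ring.
have -> : (fun y => complex.Im (f y * g y)) =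
    (fun y => complex.Re (f y)) * (fun y => complex.Im (g y)) +
    (fun y => complex.Im (f y)) * (fun y => complex.Re (g y)).
  by apply/funext => y; rewrite ImM.
apply: (is_derive_eq (is_deriveD (is_deriveM f1 g2) (is_deriveM f2 g1))).
by rewrite ImD !ImM /GRing.scale /=; ring.
Qed.

Lemma has_cderive_sum n (F : 'I_n -> R -> C) (dF : 'I_n -> C) x :
  (forall i, has_cderive (F i) x (dF i)) ->
  has_cderive (fun y => \sum_(i < n) F i y) x (\sum_(i < n) dF i).
Proof.
elim: n F dF => [|n IH] F dF FdF.
  rewrite big_ord0; have -> : (fun y => \sum_(i < 0) F i y) = fun=> 0.
    by apply/funext => y; rewrite big_ord0.
  exact: has_cderive_cst.
rewrite big_ord_recl.
have -> : (fun y => \sum_(i < n.+1) F i y) =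
    (fun y => F ord0 y + \sum_(i < n) F (lift ord0 i) y).
  by apply/funext => y; rewrite big_ord_recl.
apply: has_cderiveD; first exact: FdF.
by apply: IH => i; apply: FdF.
Qed.

Lemma has_cderive_conj f x a : has_cderive f x a ->
  has_cderive (fun y => Num.conj (f y)) x (Num.conj a).
Proof.
move=> [f1 f2]; split.
  have -> : (fun y => complex.Re (Num.conj (f y))) = (fun y => complex.Re (f y)).
    by apply/funext => y; case: (f y).
  by apply: is_derive_eq; case: (a).
have -> : (fun y => complex.Im (Num.conj (f y))) = - (fun y => complex.Im (f y)).
  by apply/funext => y /=; rewrite [RHS]/GRing.opp /=; case: (f y).
by apply: is_derive_eq; case: (a).
Qed.

Lemma has_cderive_comp f (g : R -> R) x a (b : R) :
  has_cderive f (g x) a -> is_derive x 1 g b ->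
  has_cderive (fun y => f (g y)) x (a * b%:C).
Proof.
move=> [f1 f2] gb; split.
  apply: (is_derive_eq (is_derive1_comp f1 gb)).
  by rewrite ReM /= mulr0 subr0.
apply: (is_derive_eq (is_derive1_comp f2 gb)).
by rewrite ImM /= mulr0 add0r.
Qed.

Lemma has_cderive_real (g : R -> R) x (b : R) : is_derive x 1 g b ->
  has_cderive (fun y => (g y)%:C) x b%:C.
Proof. by move=> gb; split=> //=; apply: is_derive_cst. Qed.

Lemma has_cderive_expi x : has_cderive (@expi R) x ('i * expi x).
Proof.
split=> /=.
  by apply: is_derive_eq; rewrite mul0r mul1r sub0r.
by apply: is_derive_eq; rewrite mul0r mul1r add0r.
Qed.

(** Differentiation in a real parameter on which the coefficients depend, not in the
    indeterminate. *)
Definition has_pderive (P : R -> {poly C}) x (Q : {poly C}) :=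
  forall m, has_cderive (fun y => (P y)`_m) x Q`_m.

Lemma has_pderiveC f x a : has_cderive f x a -> has_pderive (fun y => (f y)%:P) x a%:P.
Proof.
move=> fa m.
have -> : (fun y => ((f y)%:P)`_m) = if m == 0%N then f else fun=> 0.
  by apply/funext => y; rewrite coefC; case: eqP.
by rewrite coefC; case: eqP => // _; apply: has_cderive_cst.
Qed.

Lemma has_pderive_cst (P : {poly C}) x : has_pderive (fun=> P) x 0.
Proof. by move=> m; rewrite coef0; apply: has_cderive_cst. Qed.

Lemma has_pderiveD (P Q : R -> {poly C}) x (dP dQ : {poly C}) :
  has_pderive P x dP -> has_pderive Q x dQ ->
  has_pderive (fun y => P y + Q y) x (dP + dQ).
Proof.
move=> hP hQ m; rewrite coefD.
have -> : (fun y => (P y + Q y)`_m) = (fun y => (P y)`_m + (Q y)`_m).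
  by apply/funext => y; rewrite coefD.
exact: has_cderiveD.
Qed.

Lemma has_pderiveM (P Q : R -> {poly C}) x (dP dQ : {poly C}) :
  has_pderive P x dP -> has_pderive Q x dQ ->
  has_pderive (fun y => P y * Q y) x (dP * Q x + P x * dQ).
Proof.
move=> hP hQ m; rewrite coefD !coefM -big_split /=.
have -> : (fun y => (P y * Q y)`_m) = (fun y => \sum_(i < m.+1) (P y)`_i * (Q y)`_(m - i)).
  by apply/funext => y; rewrite coefM.
by apply: has_cderive_sum => i; apply: has_cderiveM.
Qed.

Lemma has_pderive_exp (P : R -> {poly C}) n x (dP : {poly C}) :
  has_pderive P x dP -> has_pderive (fun y => P y ^+ n) x (n%:R * P x ^+ n.-1 * dP).
Proof.
move=> hP; elim: n => [|n IH].
  by rewrite !mul0r; apply: has_pderive_cst.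
have -> : (fun y => P y ^+ n.+1) = (fun y => P y * P y ^+ n).
  by apply/funext => y; rewrite exprS.
have -> : n.+1%:R * P x ^+ n * dP = dP * P x ^+ n + P x * (n%:R * P x ^+ n.-1 * dP).
  by case: n {IH} => [|n] /=; rewrite ?exprS; ring.
exact: has_pderiveM.
Qed.

Lemma has_pderive_rowpoly N n f x a : has_cderive f x a ->
  has_pderive (fun y => rowpoly N (f y) n) x (a%:P * dq_rowpoly N (f x) n).
Proof.
move=> fa; have qa := has_pderiveC fa.
have ua : has_pderive (fun y => (f y)%:P + 'X) x a%:P.
  rewrite -[a%:P]addr0; apply: has_pderiveD => //; exact: has_pderive_cst.
have va : has_pderive (fun y => 1 + (f y)%:P * 'X) x (a%:P * 'X).
  rewrite -[_ * 'X]add0r; apply: has_pderiveD; first exact: has_pderive_cst.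
  rewrite -[a%:P * 'X]addr0 -[0 in X in has_pderive _ _ X](mulr0 (f x)%:P).
  by apply: (has_pderiveM qa); apply: has_pderive_cst.
have := has_pderiveM (has_pderive_exp n ua) (has_pderive_exp (N - n) va).
rewrite /rowpoly; congr has_pderive.
by rewrite /dq_rowpoly; ring.
Qed.

Definition has_mxderive m n (F : R -> 'M[C]_(m, n)) x (dF : 'M[C]_(m, n)) :=
  forall i j, has_cderive (fun y => F y i j) x (dF i j).

Lemma has_mxderiveE m n (F : R -> 'M[C]_(m, n)) x dF :
  has_mxderive F x dF -> mxderive F x = dF.
Proof.
move=> FdF; apply/matrixP => i j; have [h1 h2] := FdF i j.
rewrite mxE !derive1E !derive_val; case: (dF i j) => //.
Qed.

Lemma has_mxderive_eq m n (F : R -> 'M[C]_(m, n)) x dF dG :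
  has_mxderive F x dF -> dF = dG -> has_mxderive F x dG.
Proof. by move=> h <-. Qed.

Lemma has_mxderive_cst m n (A : 'M[C]_(m, n)) x : has_mxderive (fun=> A) x 0.
Proof. by move=> i j; rewrite mxE; apply: has_cderive_cst. Qed.

Lemma has_mxderiveM m n p (F : R -> 'M[C]_(m, n)) (G : R -> 'M[C]_(n, p)) x dF dG :
  has_mxderive F x dF -> has_mxderive G x dG ->
  has_mxderive (fun y => F y *m G y) x (dF *m G x + F x *m dG).
Proof.
move=> hF hG i j; rewrite !mxE -big_split /=.
have -> : (fun y => (F y *m G y) i j) = (fun y => \sum_k F y i k * G y k j).
  by apply/funext => y; rewrite mxE.
by apply: has_cderive_sum => k; apply: has_cderiveM.
Qed.

Lemma has_mxderiveZ m n f (F : R -> 'M[C]_(m, n)) x a dF :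
  has_cderive f x a -> has_mxderive F x dF ->
  has_mxderive (fun y => f y *: F y) x (a *: F x + f x *: dF).
Proof.
move=> hf hF i j; rewrite !mxE.
have -> : (fun y => (f y *: F y) i j) = (fun y => f y * F y i j).
  by apply/funext => y; rewrite mxE.
exact: has_cderiveM.
Qed.

Lemma has_mxderive_adj m n (F : R -> 'M[C]_(m, n)) x dF :
  has_mxderive F x dF -> has_mxderive (fun y => (F y) ^t*) x (dF ^t*).
Proof.
move=> hF i j; rewrite !mxE.
have -> : (fun y => ((F y) ^t*) i j) = (fun y => Num.conj (F y j i)).
  by apply/funext => y; rewrite !mxE.
exact: has_cderive_conj.
Qed.

Lemma has_mxderive_comp m n (F : R -> 'M[C]_(m, n)) (g : R -> R) x dF (b : R) :
  has_mxderive F (g x) dF -> is_derive x 1 g b ->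
  has_mxderive (fun y => F (g y)) x (b%:C *: dF).
Proof.
by move=> hF hg i j; rewrite mxE mulrC; apply: has_cderive_comp (hF i j) hg.
Qed.

Lemma has_mxderive_krawt N f x a : has_cderive f x a ->
  has_mxderive (fun y => krawt_mx N (f y)) x (a *: dq_krawt_mx N (f x)).
Proof.
move=> fa i j.
have -> : (fun y => krawt_mx N (f y) i j) =
    (fun y => (rowpoly N (f y) i)`_j * ('C(N, j)%:R)^-1).
  by apply/funext => y; rewrite mxE.
apply: (has_cderive_eq (has_cderiveM (has_pderive_rowpoly N i fa j) (has_cderive_cst _ _))).
by rewrite mulr0 addr0 coefCM !mxE mulrA.
Qed.

End ComplexDerivative.

(** * Derivatives of Phi_0, Psi_0 and W *)

Section PsiDerivative.
Variables (R : realType) (N : nat).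
Local Notation C := R[i].

(** Along q = e^(it), d/dt is i q d/dq, and i = (q - 1/q) / (2 sin t) supplies the factor needed for
    [dq_krawt_mxE]; [sum_krawt_mx] then moves Q to the right as Q^T. *)
Lemma has_mxderive_Phi0 (t : R) : sin t != 0 ->
  has_mxderive (Phi0 N) t ((2 * sin t)%:C^-1 *:
     (Phi0 N t *m ((N%:R * (cos t)%:C)%:M - (sum_mx C N)^T))).
Proof.
move=> st.
have -> : Phi0 N = fun t : R => expi (- (N%:R / 2) * t) *: krawt_mx N (expi t).
  by apply/funext => x; rewrite Phi0E.
have de : has_cderive (fun y : R => expi (- (N%:R / 2) * y)) t
    ('i * expi (- (N%:R / 2) * t) * (- (N%:R / 2))%:C).
  apply: has_cderive_comp; first exact: has_cderive_expi.
  by apply: is_derive_eq; rewrite /GRing.scale /= mulr1.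
have H := has_mxderiveZ de (@has_mxderive_krawt _ N _ _ _ (has_cderive_expi t)).
apply: (has_mxderive_eq H).
have q0 := expi_neq0 t; have d0 := delta_neq0 st.
have := dq_krawt_mxE N q0; rewrite sum_krawt_mx.
set D := dq_krawt_mx _ _; set e := expi (_ * t); set q := expi t; set K := krawt_mx N q.
set Y := K *m _ => E.
rewrite -scalemxAl mulmxBr mul_mx_scalar -/Y -(expi_add t) -/q [N%:R * (_ / _)]mulrC -E.
have key : (2 * sin t)%:C^-1 * (q - q^-1) = 'i%R :> C.
  have s0 : (sin t)%:C != 0 :> C by rewrite eq_complex /= (negPf st).
  by rewrite expi_sub complexiE rmorphM /= rmorph_nat; field; rewrite s0.
have -> : (- (N%:R / 2))%:C = - (N%:R / 2) :> C.
  by rewrite rmorphN rmorphM /= fmorphV !rmorph_nat.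
rewrite -key; clearbody D K; apply/matrixP => i j; rewrite !mxE; ring.
Qed.

Lemma is_derive_acos_affine (y : R) : 0 < y < 1 ->
  is_derive y 1 (fun y => acos (1 - 2 * y)) (2 / sin (acos (1 - 2 * y))).
Proof.
move=> /andP[y0 y1]; have h : -1 < 1 - 2 * y < 1 by apply/andP; split; lra.
have d1 : is_derive y 1 (fun y : R => 1 - 2 * y) (- 2).
  have -> : (fun y : R => 1 - 2 * y) = cst 1 - 2 *: (@id R) by apply/funext => z.
  apply: (is_derive_eq (is_deriveB (is_derive_cst _ _ _) (is_deriveZ _ (is_derive_id _ _)))).
  by rewrite sub0r /GRing.scale /= mulr1.
apply: (is_derive_eq (@is_derive1_comp _ _ (fun y => 1 - 2 * y) _ _ _ (is_derive1_acos h) d1)).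
move/andP: h => [h1 h2].
by rewrite sin_acos ?ltW // mulrNN mulrC.
Qed.

Lemma sin_acos_sqr (y : R) : 0 < y < 1 ->
  sin (acos (1 - 2 * y)) != 0 /\ sin (acos (1 - 2 * y)) ^+ 2 = 4 * (y * (1 - y)).
Proof.
move=> /andP[y0 y1].
have p : 0 < 4 * (y * (1 - y)) by rewrite !mulr_gt0 // subr_gt0.
have e : 1 - (1 - 2 * y) ^+ 2 = 4 * (y * (1 - y)) by ring.
rewrite sin_acos ?e; last by apply/andP; split; lra.
by rewrite sqr_sqrtr ?ltW // lt0r_neq0 // sqrtr_gt0.
Qed.

(** The chain rule contributes dt/dy = 2 / sin t, and (2 / sin t) / (2 sin t) = 1 / sin^2 t = 1 / (4
    y (1 - y)). *)
Lemma has_mxderive_Psi0 (y : R) : 0 < y < 1 ->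
  has_mxderive (Psi0 N) y (((4 * (y * (1 - y)))^-1)%:C *:
     (Psi0 N y *m ((N%:R * (1 - 2 * y)%:C)%:M - (sum_mx C N)^T))).
Proof.
move=> y01; have [s0 s2] := sin_acos_sqr y01.
apply: (has_mxderive_eq (has_mxderive_comp (has_mxderive_Phi0 s0) (is_derive_acos_affine y01))).
rewrite scalerA acosK; last by move: y01 => /andP[? ?]; rewrite in_itv /=; apply/andP; split; lra.
congr (_ *: _); rewrite -s2 -fmorphV -rmorphM; congr (_%:C).
by field.
Qed.

Lemma powR_half_succ (nu x : R) : 0 < x ->
  x `^ (nu + 1 - 1 / 2) = x * x `^ (nu - 1 / 2).
Proof.
move=> x0; rewrite addrAC [LHS]powRD; last by rewrite (lt0r_neq0 x0) implybT.
by rewrite powRr1 ?ltW // mulrC.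
Qed.

Definition weight (nu y : R) : R := (1 - y) `^ (nu - 1 / 2) * y `^ (nu - 1 / 2).

Lemma weight_gt0 nu y : 0 < y < 1 -> 0 < weight nu y.
Proof. by move=> /andP[y0 y1]; rewrite mulr_gt0 // powR_gt0 // subr_gt0. Qed.

Lemma weight_succ nu y : 0 < y < 1 -> weight (nu + 1) y = y * (1 - y) * weight nu y.
Proof.
move=> /andP[y0 y1].
by rewrite /weight !powR_half_succ ?subr_gt0 //; ring.
Qed.

Lemma is_derive_weight (nu y : R) : 0 < y < 1 ->
  is_derive y 1 (weight (nu + 1)) ((nu + 1 / 2) * (1 - 2 * y) * weight nu y).
Proof.
move=> /[dup] y01 /andP[y0 y1]; have y1' : 0 < 1 - y by rewrite subr_gt0.
pose a := nu + 1 - 1 / 2.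
have d1 : is_derive y 1 (fun y : R => 1 - y) (- 1).
  have -> : (fun y : R => 1 - y) = cst 1 - (@id R) by apply/funext => z.
  apply: (is_derive_eq (is_deriveB (is_derive_cst _ _ _) (is_derive_id _ _))).
  by rewrite sub0r.
have d2 := @is_derive1_comp _ _ (fun y => 1 - y) _ _ _ (is_derive1_powR a y1') d1.
apply: (is_derive_eq (is_deriveM d2 (is_derive1_powR a y0))).
have -> : a - 1 = nu - 1 / 2 by rewrite /a; ring.
rewrite /= /a !powR_half_succ // /weight /GRing.scale /=.
by field.
Qed.

(** The factor y (1 - y) separating the weights at nu + 1 and nu cancels the denominator in the
    derivatives of Psi_0 and of its adjoint, leaving 1/4. *)
Lemma has_mxderive_Wmx (nu y : R) : 0 < y < 1 ->
  has_mxderive (Wmx N (nu + 1)) y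
    ((weight nu y)%:C *: (Psi0 N y *m log_derivative_mx nu%:C (1 - 2 * y)%:C (Tmx N (nu + 1)) *m (Psi0 N y) ^t*)).
Proof.
move=> y01; have hP := has_mxderive_Psi0 y01.
have hW := has_mxderiveZ (has_cderive_real (is_derive_weight nu y01))
  (has_mxderiveM (has_mxderiveM hP (has_mxderive_cst (Tmx N (nu + 1)) y)) (has_mxderive_adj hP)).
apply: (has_mxderive_eq hW).
rewrite mulmx0 addr0 weight_succ // adjmxZ adjmxM /log_derivative_mx.
set c : C := N%:R * _; set S := c%:M - (sum_mx C N)^T.
have -> : S ^t* = c%:M - sum_mx C N.
  rewrite /S [(_ - _)^T]linearB /= tr_scalar_mx map_mxB /= map_scalar_mx /=.
  rewrite -adj_sum_mx trmxCK; congr (_%:M - _).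
  by rewrite /c rmorphM /= rmorph_nat; congr (_ * _); apply: conjc_real.
set S' := c%:M - _; set P := Psi0 N y; set T := Tmx N (nu + 1).
have -> : Num.conj ((4 * (y * (1 - y)))^-1)%:C = ((4 * (y * (1 - y)))^-1)%:C :> C.
  exact: conjc_real.
set k : C := (_^-1)%:C; set w := weight nu y.
have kE : (y * (1 - y) * w)%:C * k = w%:C * 4^-1 :> C.
  have -> : 4^-1 = (4^-1)%:C :> C by rewrite fmorphV rmorph_nat.
  rewrite -!rmorphM /=; congr (_%:C).
  by move: y01 => /andP[y0 y1]; field; rewrite (lt0r_neq0 y0) subr_eq0 (gt_eqF y1).
have wE : ((nu + 1 / 2) * (1 - 2 * y) * w)%:C = w%:C * ((nu%:C + 1 / 2) * (1 - 2 * y)%:C) :> C.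
  by rewrite mulrC !rmorphM rmorphD /= rmorphM fmorphV /= rmorph1 rmorph_nat.
rewrite {}wE; clearbody S S' k P T.
rewrite -!scalemxAl -scalemxAr -scalerDr scalerA kE -!scalerA -scalerDr; congr (_ *: _).
by rewrite mulmxDr mulmxDl -!scalemxAr -!scalemxAl mulmxDr mulmxDl !mulmxA.
Qed.

Lemma WmxE (nu y : R) : Wmx N nu y =
  (weight nu y)%:C *: (Psi0 N y *m Tmx N nu *m (Psi0 N y) ^t*).
Proof. by []. Qed.

End PsiDerivative.

(** For W^-1 W', the scalar weight and the left factor Psi_0 cancel, so only conjugation by V is
    left. *)
Lemma invmx_mul_scale (F : fieldType) n (w : F) (P T V M : 'M[F]_n) :
  w != 0 -> P \in unitmx -> T \in unitmx -> V \in unitmx ->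
  invmx (w *: (P *m T *m V)) *m (w *: (P *m M *m V)) =
  invmx V *m invmx T *m M *m V.
Proof.
move=> w0 Pu Tu Vu; apply: (canLR (mulKmx _)).
  by rewrite unitmxZ ?unitfE // !unitmx_mul Pu Tu Vu.
by rewrite -scalemxAl -!mulmxA mulKVmx // mulKVmx.
Qed.

(** * Explicit formulas for Gamma_2 and Gamma_1, and their degrees *)

Section Main.
Variables (R : realType) (N : nat) (nu : R).
Hypothesis nu_gt0 : 0 < nu.
Local Notation C := R[i].
Local Notation H := (weight_mx C N).
Let kappa : C := nu%:C * (nu%:C + N%:R).
Let b : C := nu%:C + N%:R / 2.

Let nuC_gt0 : 0 < nu%:C. Proof. by rewrite ltcR. Qed.
Let t_succ m : (m < N)%N -> m.+1%:R * (nu%:C + N%:R - m.+1%:R) * (Tcoef N nu m.+1)%:C =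
  (N%:R - m%:R) * (nu%:C + m%:R) * (Tcoef N nu m)%:C.
Proof.
move=> h; have := congr1 (real_complex R) (Tcoef_succ nu_gt0 h).
by rewrite !(rmorphM, rmorphB, rmorphD) /= !rmorph_nat.
Qed.
Let t_shift m : (m <= N)%N -> nu%:C * (nu%:C + N%:R) * (Tcoef N (nu + 1) m)%:C =
  (nu%:C + m%:R) * (nu%:C + N%:R - m%:R) * (Tcoef N nu m)%:C.
Proof.
move=> h; have := congr1 (real_complex R) (Tcoef_shift nu_gt0 h).
by rewrite !(rmorphM, rmorphB, rmorphD) /= !rmorph_nat.
Qed.
Let t_neq0 m : (m <= N)%N -> (Tcoef N nu m)%:C != 0.
Proof. by move=> h; rewrite fmorph_eq0 lt0r_neq0 // Tcoef_gt0. Qed.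

Let kappa_neq0 : kappa != 0.
Proof. by rewrite mulf_neq0 ?lt0r_neq0 // ltr_pwDl. Qed.

(** The left side is the (0, 0) entry of H^2 - b^2, since H has -N/2 there. *)
Let b2_sub : (N%:R / 2) ^+ 2 - b ^+ 2 = - kappa.
Proof. by rewrite /b /kappa; field. Qed.

Let adjPsi0_unit (y : R) : 0 < y < 1 -> (Psi0 N y) ^t* \in unitmx.
Proof. by move=> /sin_acos_sqr[s0 _]; apply: V_unit. Qed.

Let cos_acosK (y : R) : 0 < y < 1 -> cos (acos (1 - 2 * y)) = 1 - 2 * y.
Proof.
by move=> /andP[? ?]; rewrite acosK // in_itv /=; apply/andP; split; lra.
Qed.

Lemma Gamma2E (y : R) : 0 < y < 1 -> Gamma2 N nu y =
  kappa^-1 *: ((b ^+ 2 * (y * (1 - y))%:C)%:M +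
     16^-1 *: ((Kmx N (1 - 2 * y)%:C)^T *m (Kmx N (1 - 2 * y)%:C)^T)).
Proof.
move=> y01; have [s0 s2] := sin_acos_sqr y01.
have VK := V_K N (acos (1 - 2 * y)); rewrite cos_acosK // in VK.
have d0 := delta_neq0 s0.
have E := conj_shift nuC_gt0 t_shift t_neq0 (adjPsi0_unit y01) d0 VK.
rewrite /Gamma2 (TmxE N nu_gt0).
rewrite (TmxE N (addr_gt0 nu_gt0 ltr01)).
rewrite E.
set d := expi _ - _ in E d0 *.
(* Since d = 2 i sin t, d^2 = -4 sin^2 t = -16 y (1 - y): the prefactor of Gamma_2 cancels the pole
   of d^-2. *)
have dE : (y * (1 - y))%:C * d ^- 2 = - 16^-1.
  have d2 : d ^+ 2 = - 16 * (y * (1 - y))%:C.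
    rewrite /d expi_sub complexiE !exprMn sqrCi.
    have -> : (sin (acos (1 - 2 * y)))%:C ^+ 2 = 4 * (y * (1 - y))%:C.
      by rewrite -rmorphXn /= s2 rmorphM /= rmorph_nat.
    by ring.
  have := expf_neq0 2 d0; rewrite d2 mulf_eq0 negb_or => /andP[_ z0].
  by move: (_%:C) z0 => z z0; field.
rewrite scalerA mulrC -scalerA; congr (_ *: _).
by rewrite scalerBr scalerA dE scaleNr opprK scale_scalar_mx; congr (_%:M + _); rewrite mulrC.
Qed.

Lemma Gamma1E (y : R) : 0 < y < 1 -> Gamma1 N nu y =
  ((nu%:C + (N%:R + 1) / 2) / kappa) *:
    (((1 - 2 * y)%:C * b ^+ 2)%:M - (b / 2) *: (sum_mx C N)^T
       + 2^-1 *: ((Kmx N (1 - 2 * y)%:C)^T *m H)).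
Proof.
move=> y01; have [s0 s2] := sin_acos_sqr y01.
have VK := V_K N (acos (1 - 2 * y)); rewrite cos_acosK // in VK.
have KV := K_V N (acos (1 - 2 * y)); rewrite cos_acosK // in KV.
have QV := sum_V N (acos (1 - 2 * y)).
have Vu := adjPsi0_unit y01.
have E := conj_derivative nuC_gt0 t_succ t_shift t_neq0 Vu QV VK KV.
rewrite /Gamma1 (has_mxderiveE (has_mxderive_Wmx nu y01)) WmxE.
rewrite (TmxE N nu_gt0) (TmxE N (addr_gt0 nu_gt0 ltr01)); apply: (etrans _ E).
have Tu := diag_unitmx t_neq0; set T := diag_mx _ in Tu *.
have w0 : (weight nu y)%:C != 0 :> C by rewrite fmorph_eq0 lt0r_neq0 // weight_gt0.
have Pu : Psi0 N y \in unitmx by rewrite -[Psi0 N y]trmxCK map_unitmx unitmx_tr.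
exact: (@invmx_mul_scale C N.+1 (weight nu y)%:C (Psi0 N y) T ((Psi0 N y) ^t*) _ w0 Pu Tu Vu).
Qed.

Let weight2_00 : (H *m H) 0 0 = (N%:R / 2) ^+ 2.
Proof. by rewrite mul_weight_mx !mxE eqxx mulr1n sub0r mulrNN -expr2. Qed.

Lemma Kmx_affine (y : R) : (Kmx N (1 - 2 * y)%:C)^T = (Kmx N (1 : C))^T + (4 * y%:C) *: H.
Proof.
rewrite -[in RHS]weight_mxT; apply/matrixP => i j; rewrite !mxE.
by rewrite rmorphB rmorphM /= rmorph_nat rmorph1; ring.
Qed.

Lemma Gamma2_polynomial : matrix_polynomial_of_degree 2 (Gamma2 N nu).
Proof.
set A := (Kmx N (1 : C))^T.
(* With K^T = A + 4 y H, these are the coefficients of b^2 y (1 - y) + (A + 4 y H)^2 / 16, divided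
   by [kappa]; A and H need not commute. *)
exists (Poly [:: (16 * kappa)^-1 *: (A *m A);
  kappa^-1 *: ((b ^+ 2)%:M + 4^-1 *: (A *m H + H *m A));
  kappa^-1 *: (H *m H - (b ^+ 2)%:M)]); split.
  (* The (0, 0) entry of the leading coefficient is -1. *)
  rewrite (@PolyK _ 0) //=; apply/eqP => /matrixP/(_ 0 0).
  by move: (H *m H) weight2_00 => X X00; rewrite !mxE X00 eqxx mulr1n b2_sub mulrN mulVf // => /eqP; rewrite oppr_eq0 oner_eq0.
move=> y y01; rewrite Gamma2E // horner_Poly /= mul0r add0r -!mulmxE !mul_mx_scalar.
rewrite Kmx_affine -/A mulmxDl !mulmxDr -!scalemxAl -!scalemxAr.
move: (A *m A) (A *m H) (H *m A) (H *m H) => X1 X2 X3 X4.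
apply/matrixP => i j; rewrite !mxE rmorphM rmorphB rmorph1 /=.
by case: (i == j); rewrite ?mulr1n ?mulr0n; field.
Qed.

Lemma Gamma1_polynomial : matrix_polynomial_of_degree 1 (Gamma1 N nu).
Proof.
set A := (Kmx N (1 : C))^T; set s := nu%:C + (N%:R + 1) / 2.
have s0 : s != 0.
  by rewrite lt0r_neq0 // ltr_pwDl // divr_ge0 ?addr_ge0.
(* The linear coefficient collects -2 b^2 from (1 - 2 y) b^2 and 2 H^2 from (A + 4 y H) H / 2. *)
exists (Poly [:: (s / kappa) *: ((b ^+ 2)%:M - (b / 2) *: (sum_mx C N)^T + 2^-1 *: (A *m H));
  (2 * s / kappa) *: (H *m H - (b ^+ 2)%:M)]); split.
  (* Here the (0, 0) entry of the leading coefficient is -2 [s], nonzero because [s] is positive. *)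
  rewrite (@PolyK _ 0) //=; apply/eqP => /matrixP/(_ 0 0).
  by move: (H *m H) weight2_00 => X X00; rewrite !mxE X00 eqxx mulr1n b2_sub mulrN divfK // => /eqP; rewrite oppr_eq0 mulf_eq0 pnatr_eq0 (negPf s0).
move=> y y01; rewrite Gamma1E // horner_Poly /= mul0r add0r -!mulmxE !mul_mx_scalar.
rewrite Kmx_affine -/A -/s mulmxDl -!scalemxAl.
move: (A *m H) (H *m H) (sum_mx C N)^T => X1 X2 X3.
have -> : (1 - 2 * y)%:C = 1 - 2 * y%:C :> C.
  by rewrite rmorphB rmorphM rmorph1 rmorph_nat.
apply/matrixP => i j; rewrite !mxE.
by case: (i == j); rewrite ?mulr1n ?mulr0n; field.
Qed.

End Main.

Theorem proposition3p6 (R : realType) (N : nat) (nu : R) (hnu : 1 <= nu) :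
  matrix_polynomial_of_degree 2 (Gamma2 N nu) /\
  matrix_polynomial_of_degree 1 (Gamma1 N nu).
Proof.
have nu_gt0 : 0 < nu := lt_le_trans ltr01 hnu.
by split; [apply: Gamma2_polynomial | apply: Gamma1_polynomial].
Qed.
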